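(* Let $F(x)=\frac{f(x)+h(x)}{g(x)}$ on $\mathbb{R}^n$, with $f,h,g$ as in the context and $g$ concave and differentiable. Then: (i) $F$ is quasiconvex: $F(\alpha x+(1-\alpha)y)\le\max(F(x),F(y))$ for all $\alpha\in[0,1]$ and all $x,y$. (ii) Any critical point of the problem $\min_{x\in\mathbb{R}^n}F(x)$ is a global minimum.
   Context: Standing assumptions. $F$ takes only finite values, with $f(x)+h(x)\ge 0$ and $g(x)>0$ for all $x$. The function $f$ is convex and differentiable, and there is $c\in\mathbb{R}^n$ with $c_i\ge 0$ such that $f(x+\eta e_i)\le f(x)+\nabla_i f(x)\eta+\frac{c_i}{2}\eta^2$ for all $x\in\mathbb{R}^n$, $\eta\in\mathbb{R}$, $i=1,\dots,n$. The function $h$ is convex and separable: $h(x)=\sum_{i=1}^n h_i(x_i)$. A critical point is a point $\check x$ with $0\in\nabla f(\check x)+\partial h(\check x)-F(\check x)\,\partial g(\check x)$, where $\partial h$ is the convex subdifferential and $\partial g(\check x)=\{\nabla g(\check x)\}$ since $g$ is differentiable. *)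

(* Defs.v *)
From HB Require Import structures.
From mathcomp Require Import all_boot all_order all_algebra.
From mathcomp Require Import all_classical all_reals all_analysis.
Set Implicit Arguments.
Unset Strict Implicit.
Unset Printing Implicit Defensive.
Import Order.TTheory GRing.Theory Num.Theory.
Import numFieldNormedType.Exports.
Local Open Scope classical_set_scope.
Local Open Scope convex_scope.
Local Open Scope ring_scope.

Section fractional_minimization.
Context {R : realType} {n : nat}.
Implicit Types (f g h : 'rV[R]_n -> R) (x : 'rV[R]_n).

Definition dotv (u v : 'rV[R]_n) : R := \sum_(i < n) u ord0 i * v ord0 i.

Definition basis_vec (i : 'I_n) : 'rV[R]_n := delta_mx ord0 i.

Definition grad f x : 'rV[R]_n := \row_(i < n) 'D_(basis_vec i) f x.

Definition concave_function (E : lmodType R) (E' := convex_lmodType E)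
    (D : set E') (g : E' -> R^o) :=
  forall (t : {i01 R}),
    {in D &, forall (x y : E'), (g x <| t |> g y <= g (x <| t |> y))%R}.

Definition coord_separable h :=
  exists hi : 'I_n -> R -> R, forall x, h x = \sum_(i < n) hi i (x ord0 i).

Definition coordinate_lipschitz_grad f (c : 'rV[R]_n) :=
  forall x (eta : R) (i : 'I_n),
    f (x + eta *: basis_vec i)
      <= f x + grad f x ord0 i * eta + c ord0 i / 2 * eta ^+ 2.

Definition subdiff h x : set 'rV[R]_n :=
  [set v | forall y, h x + dotv v (y - x) <= h y].

Definition frac_obj f h g x : R := (f x + h x) / g x.

(* [set grad g x] stands for the subdifferential of the differentiable
   function g, so that the set below is grad f x + subdiff h x - F x * dg(x) *)
Definition critical_point f h g x : Prop :=
  [set grad f x + v - frac_obj f h g x *: w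
    | v in subdiff h x & w in [set grad g x]] 0.

Definition global_minimum (F : 'rV[R]_n -> R) x := forall y, F x <= F y.

Definition quasiconvex (F : 'rV[R]_n -> R) :=
  forall (alpha : R) (x y : 'rV[R]_n), 0 <= alpha <= 1 ->
    F (alpha *: x + (1 - alpha) *: y) <= Num.max (F x) (F y).

End fractional_minimization.

(* Main.v *)
(** A fractional objective [F = (f + h) / g] satisfies [F x <= M] iff
    [f x + h x <= M * g x], and for [M >= 0] the function [f + h - M * g] is
    convex; so the sublevel sets of [F] are convex.  At a critical point [x],
    the first-order inequalities for [f], [h] and [g] add up to
    [f y + h y - F x * g y >= f x + h x - F x * g x = 0], using [F x >= 0]. *)
Require Import Defs.
From HB Require Import structures.
From mathcomp Require Import all_boot all_order all_algebra.
From mathcomp Require Import all_classical all_reals all_analysis.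
From mathcomp Require Import lra.
Import Order.TTheory GRing.Theory Num.Theory.
Import numFieldNormedType.Exports.
Local Open Scope classical_set_scope.
Local Open Scope ring_scope.

Lemma convex_functionT_le (R : realType) (E : lmodType R) (f : E -> R)
    (a : R) (x y : E) :
  convex_function [set: E] f -> 0 <= a <= 1 ->
  f (a *: x + (1 - a) *: y) <= a * f x + (1 - a) * f y.
Proof.
move=> cf /andP[a0 a1].
by have /= := cf (Itv01 a0 a1) x y (mem_set I) (mem_set I).
Qed.

Lemma concave_functionT_oppr (R : realType) (E : lmodType R) (g : E -> R) :
  concave_function [set: E] g -> convex_function [set: E] (- g).
Proof.
move=> cg t x y xT yT; have := cg t x y xT yT.
by rewrite -lerN2 convN.
Qed.

Lemma concave_functionT_ge (R : realType) (E : lmodType R) (g : E -> R)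
    (a : R) (x y : E) :
  concave_function [set: E] g -> 0 <= a <= 1 ->
  a * g x + (1 - a) * g y <= g (a *: x + (1 - a) *: y).
Proof.
move=> /concave_functionT_oppr cg a01.
have := convex_functionT_le _ _ _ _ x y cg a01.
by rewrite !fctE !mulrN -opprD lerN2.
Qed.

(** Convexity along the segment from [x] to [y] bounds each difference quotient with step in (0, 1]
    by [f y - f x]; the bound survives the limit. *)
Lemma convex_derive_le (R : realType) (V : normedModType R) (f : V -> R)
    (x y : V) :
  convex_function [set: V] f -> derivable f x (y - x) ->
  'D_(y - x) f x <= f y - f x.
Proof.
move=> cf df.
(* The quotient bound holds for positive steps only, so the two-sided limit is restricted to the
   right of 0. *)
suff : h^-1 *: (f (h *: (y - x) + x) - f x) @[h --> 0^'+] --> 'D_(y - x) f x.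
  move=> /cvgr_to_le; apply; near=> t.
  have t0 : 0 < t by near: t; exact: nbhs_right_gt.
  have t1 : t <= 1 by near: t; exact: nbhs_right_le.
  have -> : t *: (y - x) + x = t *: y + (1 - t) *: x.
    by rewrite scalerBr scalerBl scale1r addrAC addrA.
  have /= := convex_functionT_le _ _ _ t y x cf.
  rewrite (ltW t0) t1 => /(_ isT) cft.
  rewrite /GRing.scale/= mulrC ler_pdivrMr//; lra.
exact: (cvg_dnbhs_at_right df).
Unshelve. all: by end_near. Qed.

(** [grad] only collects partial derivatives; differentiability makes the derivative linear in the
    direction, so [v] can be expanded in the standard basis. *)
Lemma derive_dotv (R : realType) (n : nat) (f : 'rV[R]_n -> R)
    (x v : 'rV[R]_n) :
  differentiable f x -> 'D_v f x = dotv (grad f x) v.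
Proof.
move=> df; rewrite deriveE// {1}(row_sum_delta v) linear_sum.
apply: eq_bigr => i _.
by rewrite linearZ mxE deriveE//= mulrC.
Qed.

Lemma convex_grad_le (R : realType) (n : nat) (f : 'rV[R]_n -> R)
    (x y : 'rV[R]_n) :
  convex_function [set: 'rV[R]_n] f -> differentiable f x ->
  f x + dotv (grad f x) (y - x) <= f y.
Proof.
move=> cf df; rewrite -derive_dotv// addrC -lerBrDr.
by apply: convex_derive_le => //; exact: diff_derivable.
Qed.

Lemma concave_grad_ge (R : realType) (n : nat) (g : 'rV[R]_n -> R)
    (x y : 'rV[R]_n) :
  concave_function [set: 'rV[R]_n] g -> differentiable g x ->
  g y <= g x + dotv (grad g x) (y - x).
Proof.
move=> /concave_functionT_oppr cg dg.
have dgv : derivable g x (y - x) by exact: diff_derivable.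
have := convex_derive_le _ _ _ _ _ cg (derivableN dgv).
by rewrite deriveN// derive_dotv// !fctE; lra.
Qed.

Lemma frac_obj_quasiconvex (R : realType) (n : nat) (f h g : 'rV[R]_n -> R) :
  (forall x, 0 <= f x + h x) -> (forall x, 0 < g x) ->
  convex_function [set: 'rV[R]_n] f -> convex_function [set: 'rV[R]_n] h ->
  concave_function [set: 'rV[R]_n] g ->
  quasiconvex (frac_obj f h g).
Proof.
move=> fh0 g0 cf ch cg a x y a01; have /andP[a0 a1] := a01.
set M := Num.max _ _; rewrite /frac_obj ler_pdivrMr//.
have sublevel z : frac_obj f h g z <= M -> f z + h z <= M * g z.
  by rewrite /frac_obj ler_pdivrMr.
have xM : f x + h x <= M * g x by rewrite sublevel// le_max lexx.
have yM : f y + h y <= M * g y by rewrite sublevel// le_max lexx orbT.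
(* The sign of [M] lets the concavity inequality of [g] be multiplied by [M] without reversing. *)
have M0 : 0 <= M by rewrite le_max divr_ge0// ltW.
have fa := convex_functionT_le _ _ _ _ x y cf a01.
have ha := convex_functionT_le _ _ _ _ x y ch a01.
have ga := ler_wpM2l M0 (concave_functionT_ge _ _ _ _ x y cg a01).
have a1' : 0 <= 1 - a by rewrite subr_ge0.
have xa := ler_wpM2l a0 xM; have ya := ler_wpM2l a1' yM.
apply: le_trans ga; apply: le_trans (lerD fa ha) _.
(* Both remaining goals only regroup terms: by endpoint on the left, factoring out [M] on the
   right. *)
by apply: le_trans (le_trans _ (lerD xa ya)) _; lra.
Qed.

Lemma critical_point_global_minimum (R : realType) (n : nat)
    (f h g : 'rV[R]_n -> R) (x : 'rV[R]_n) :
  0 <= f x + h x -> (forall y, 0 < g y) ->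
  convex_function [set: 'rV[R]_n] f -> differentiable f x ->
  concave_function [set: 'rV[R]_n] g -> differentiable g x ->
  critical_point f h g x -> global_minimum (frac_obj f h g) x.
Proof.
move=> fh0 g0 cf df cg dg [v vh [_ ->]] crit y.
have F0 : 0 <= frac_obj f h g x by rewrite divr_ge0// ltW.
rewrite [leRHS]/frac_obj ler_pdivlMr//.
have Fx : frac_obj f h g x * g x = f x + h x by rewrite divfK// gt_eqF.
move: F0 Fx crit; set F := frac_obj f h g x => F0 Fx crit.
(* The criticality equation, paired with [y - x] coordinate by coordinate. *)
have dot0 : dotv (grad f x) (y - x) + dotv v (y - x)
    = F * dotv (grad g x) (y - x).
  rewrite /dotv mulr_sumr -big_split; apply: eq_bigr => i _ /=.
  have /rowP/(_ i) := crit; rewrite !mxE => criti.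
  by rewrite -mulrDl mulrA; congr (_ * _); lra.
have fy := convex_grad_le _ _ _ _ y cf df.
have gy := ler_wpM2l F0 (concave_grad_ge _ _ _ _ y cg dg).
have hy := vh y.
(* In the sum of [fy], [hy] and [gy], the first-order terms cancel by [dot0] and the values at [x]
   by [Fx]. *)
rewrite mulrDr in gy; lra.
Qed.

Theorem proposition5p16 (R : realType) (n : nat) (f h g : 'rV[R]_n -> R)
  (fh_ge0 : forall x, 0 <= f x + h x)
  (g_gt0 : forall x, 0 < g x)
  (f_convex : convex_function [set: 'rV[R]_n] f)
  (f_diff : forall x, differentiable f x)
  (f_lip : exists c : 'rV[R]_n,
     (forall i, 0 <= c ord0 i) /\ coordinate_lipschitz_grad f c)
  (h_convex : convex_function [set: 'rV[R]_n] h)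
  (h_sep : coord_separable h)
  (g_concave : concave_function [set: 'rV[R]_n] g)
  (g_diff : forall x, differentiable g x) :
  quasiconvex (frac_obj f h g) /\
  (forall x, critical_point f h g x -> global_minimum (frac_obj f h g) x).
Proof.
split; first exact: frac_obj_quasiconvex.
by move=> x; exact: critical_point_global_minimum.
Qed.
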